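(* Let $\mathcal{O}=\{t_1,\dots,t_\mu\}$ be an order ideal in $\mathbb{T}^n$. For every set $L=\{s_1,\dots,s_\mu\}\subset\mathbb{T}^n$ of $\mu$ distinct terms, we have $\Delta_L/\Delta_{\mathcal{O}}\in C_{\mathcal{O}}$.
   Context: $K$ is a field and $\mathbb{T}^n$ is the monoid of terms in $x_1,\dots,x_n$. An order ideal is a finite nonempty set $\mathcal{O}\subset\mathbb{T}^n$ closed under forming divisors, with border $\partial\mathcal{O}=(x_1\mathcal{O}\cup\cdots\cup x_n\mathcal{O})\setminus\mathcal{O}=\{b_1,\dots,b_\nu\}$. Let $Q=K[y_k^{(i)}\mid i=1,\dots,\mu,\ k=1,\dots,n]$ be a polynomial ring, $\mathbf{y}^{(i)}=(y_1^{(i)},\dots,y_n^{(i)})$, and for a term $t$ let $t(\mathbf{y}^{(i)})$ be the result of substituting $x_k\mapsto y_k^{(i)}$ in $t$. For a set $L=\{s_1,\dots,s_\mu\}$ of $\mu$ distinct terms (listed in a fixed order) put $\Delta_L=\det\bigl(s_j(\mathbf{y}^{(i)})\bigr)_{i,j=1,\dots,\mu}\in Q$. In particular $\Delta_{\mathcal{O}}=\det\bigl(t_j(\mathbf{y}^{(i)})\bigr)_{i,j}$, which is nonzero. For $1\le i\le\mu$, $1\le j\le\nu$, let $\Delta_{ij}\in Q$ be the determinant of the matrix obtained from $\bigl(t_j(\mathbf{y}^{(i)})\bigr)_{i,j}$ by replacing its $i$-th column by $(b_j(\mathbf{y}^{(1)}),\dots,b_j(\mathbf{y}^{(\mu)}))^{\rm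 tr}$. $C_{\mathcal{O}}$ is the $K$-subalgebra of the quotient field of $Q$ generated by all $\Delta_{ij}/\Delta_{\mathcal{O}}$. *)

(* Defs.v *)
From HB Require Import structures.
From mathcomp Require Import all_boot all_order all_algebra.
From mathcomp Require Import fraction.
From mathcomp.multinomials Require Import mpoly.

Set Implicit Arguments.
Unset Strict Implicit.
Unset Printing Implicit Defensive.

Import GRing.Theory.
Local Open Scope ring_scope.

Notation "x %:F" := (tofrac x) : ring_scope.

(* Terms are the monomials 'X_{1..n}, written additively in multi_scope: the  *)
(* product of terms is (t + u)%MM, x_k is U_(k)%MM, and u divides t exactly   *)
(* when (u <= t)%MM. A finite set of terms is given by a sequence.            *)

Definition order_ideal (n : nat) (O : seq 'X_{1..n}) : Prop :=
  O != [::] /\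
  forall t u : 'X_{1..n}, t \in O -> (u <= t)%MM -> u \in O.

Definition border (n : nat) (O : seq 'X_{1..n}) : seq 'X_{1..n} :=
  [seq b <- [seq (U_(k) + t)%MM | k <- enum 'I_n, t <- O] | b \notin O].

Section Determinants.

Variables (K : fieldType) (n mu : nat).

(* Q = K[y_k^(i)]: mxvec_index is the bijection 'I_mu * 'I_n ~ 'I_(mu * n). *)
Definition Qring : idomainType := {mpoly K[mu * n]}.

Definition yvar (i : 'I_mu) (k : 'I_n) : Qring := 'X_(mxvec_index i k).

Definition term_at (t : 'X_{1..n}) (i : 'I_mu) : Qring := mmap1 (yvar i) t.

Definition Delta (s : mu.-tuple 'X_{1..n}) : Qring :=
  \det (\matrix_(i < mu, j < mu) term_at (tnth s j) i).

Definition Delta_border (t : mu.-tuple 'X_{1..n}) (nu : nat)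
    (b : nu.-tuple 'X_{1..n}) (i : 'I_mu) (j : 'I_nu) : Qring :=
  \det (\matrix_(p < mu, q < mu)
    if q == i then term_at (tnth b j) p else term_at (tnth t q) p).

Definition scalar_frac : {rmorphism K -> {fraction Qring}} :=
  @tofrac Qring \o @mpolyC (mu * n) K.

End Determinants.

(* The subalgebra generated by G of a ring A made into a K-algebra by iota;   *)
(* opposites come from the scalar -1.                                         *)
Inductive subalgebra_gen (K A : nzRingType)
    (iota : {rmorphism K -> A}) (G : A -> Prop) :
  A -> Prop :=
| subalgebra_gen_scalar c : subalgebra_gen iota G (iota c)
| subalgebra_gen_gen x : G x -> subalgebra_gen iota G x
| subalgebra_gen_add x y : subalgebra_gen iota G x ->
    subalgebra_gen iota G y -> subalgebra_gen iota G (x + y)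
| subalgebra_gen_mul x y : subalgebra_gen iota G x ->
    subalgebra_gen iota G y -> subalgebra_gen iota G (x * y).

Definition C_alg (K : fieldType) (n mu nu : nat) (t : mu.-tuple 'X_{1..n})
    (b : nu.-tuple 'X_{1..n}) : {fraction Qring K n mu} -> Prop :=
  subalgebra_gen (@scalar_frac K n mu)
    (fun x => exists (i : 'I_mu) (j : 'I_nu),
       x = (Delta_border K t b i j)%:F / (Delta K t)%:F).

(* Main.v *)
Require Import Defs.
From mathcomp Require Import all_boot all_order all_algebra.
From mathcomp Require Import fraction.
From mathcomp.multinomials Require Import mpoly.

Import GRing.Theory.

Local Open Scope ring_scope.

(** Let [T] be the matrix of values of the terms of the order ideal O at the
    generic points, over the quotient field F of Q. If [\det T] vanishes the
    quotient is 0 by convention; otherwise the values of any term [m] at the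
    points form a column vector with a unique coordinate vector with respect to
    the columns of [T]. All these coordinates lie in C_O: multiplication by
    [x_k] acts on columns by the diagonal matrix of the values of [x_k], so the
    coordinates of [x_k m] are bilinear in those of [m] and those of the
    products [x_k t_j], and each [x_k t_j] lies in O (unit coordinate vector) or
    in the border (coordinates [Delta_ij / Delta_O] by Cramer's rule). An
    induction on [m] starting from [1 \in O] concludes
    ([coords_in_subalgebra]). Finally, the matrix of values of s_1, ..., s_mu is
    [T] times the matrix of coordinates of the s_j, so that
    [Delta_L / Delta_O] is the determinant of the latter, a polynomial
    expression in elements of C_O. *)

Section SubalgebraClosure.

Context {K : nzRingType} {A : comNzRingType} {iota : {rmorphism K -> A}}.
Context {G : A -> Prop}.
Local Notation S := (subalgebra_gen iota G).

Lemma subalgebra_gen0 : S 0.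
Proof. by rewrite -(rmorph0 iota); apply: subalgebra_gen_scalar. Qed.

Lemma subalgebra_gen1 : S 1.
Proof. by rewrite -(rmorph1 iota); apply: subalgebra_gen_scalar. Qed.

Lemma subalgebra_gen_sum (I : finType) (f : I -> A) :
  (forall i, S (f i)) -> S (\sum_i f i).
Proof.
move=> Sf; apply: big_ind => //; first exact: subalgebra_gen0.
by move=> x y; apply: subalgebra_gen_add.
Qed.

Lemma subalgebra_gen_prod (I : finType) (f : I -> A) :
  (forall i, S (f i)) -> S (\prod_i f i).
Proof.
move=> Sf; apply: big_ind => //; first exact: subalgebra_gen1.
by move=> x y; apply: subalgebra_gen_mul.
Qed.

Lemma subalgebra_gen_det (m : nat) (M : 'M[A]_m) :
  (forall i j, S (M i j)) -> S (\det M).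
Proof.
move=> SM; apply: subalgebra_gen_sum => p; apply: subalgebra_gen_mul.
  by rewrite -(rmorph_sign iota); apply: subalgebra_gen_scalar.
exact: subalgebra_gen_prod.
Qed.

End SubalgebraClosure.

(** Cramer's rule: both sides are the expansion along column [i] of the matrix
    with that column replaced, whose cofactors there are those of [M]. *)
Lemma cramer_rule (F : fieldType) (m : nat) (M : 'M[F]_m) (c : 'cV[F]_m)
    (i : 'I_m) : M \in unitmx ->
  (invmx M *m c) i 0 =
    \det (\matrix_(p, q) if q == i then c p 0 else M p q) / \det M.
Proof.
move=> Munit; rewrite /invmx Munit -scalemxAl mxE mulrC; congr (_ / _).
rewrite (expand_det_col _ i) mxE; apply: eq_bigr => p _.
rewrite !mxE eqxx mulrC; congr (_ * (_ * \det _)).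
by apply/matrixP => a d; rewrite !mxE eq_sym (negPf (neq_lift _ _)).
Qed.

Section CoordinatesOfTerms.

Context {F : fieldType} {n mu : nat}.
Context (e : 'I_mu -> 'X_{1..n} -> F).
Hypothesis eD : forall i u v, e i (u + v)%MM = e i u * e i v.
Context (t : mu.-tuple 'X_{1..n}).

Definition eval_mx (s : mu.-tuple 'X_{1..n}) : 'M[F]_mu :=
  \matrix_(i, j) e i (tnth s j).

Definition coords (m : 'X_{1..n}) : 'cV[F]_mu :=
  invmx (eval_mx t) *m \col_i e i m.

Hypothesis t_unit : eval_mx t \in unitmx.

Lemma eval_coords (m : 'X_{1..n}) (i : 'I_mu) :
  e i m = \sum_j e i (tnth t j) * coords m j 0.
Proof.
have := congr1 (fun c : 'cV_mu => c i 0) (mulKVmx t_unit (\col_i e i m)).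
rewrite -/(coords m) !mxE => <-.
by apply: eq_bigr => j _; rewrite mxE.
Qed.

Lemma coords_tnth (j : 'I_mu) : coords (tnth t j) = col j 1%:M.
Proof.
rewrite -(mulVmx t_unit) colE -mulmxA -colE; congr (_ *m _).
by apply/colP => i; rewrite !mxE.
Qed.

(** Multiplication by [u] acts on columns of values as a diagonal matrix, hence
    linearly: it turns the expansion of the column of [m] over the [t_j] into
    an expansion of the column of [u + m] over the [u + t_j]. *)
Lemma coordsD (u m : 'X_{1..n}) :
  coords (u + m)%MM = \sum_j coords m j 0 *: coords (u + tnth t j)%MM.
Proof.
rewrite {1}/coords.
under eq_bigr do rewrite scalemxAr.
rewrite -mulmx_sumr; congr (_ *m _); apply/colP => i.
rewrite mxE summxE eD (eval_coords m) mulr_sumr; apply: eq_bigr => j _.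
by rewrite !mxE eD mulrA mulrC.
Qed.

Lemma det_coords (s : mu.-tuple 'X_{1..n}) :
  \det (eval_mx s) / \det (eval_mx t) =
  \det (\matrix_(i, j) coords (tnth s j) i 0).
Proof.
have t_det : \det (eval_mx t) != 0 by rewrite -unitfE -unitmxE.
apply: (mulIf t_det); rewrite divfK // mulrC -det_mulmx; congr (\det _).
apply/matrixP => i j; rewrite !mxE eval_coords.
by apply: eq_bigr => k _; rewrite !mxE.
Qed.

(** By induction on the degree: if [x_k] divides [m], then [coordsD] expresses
    the coordinates of [m] through those of [m / x_k] and of the [x_k t_j], and
    each [x_k t_j] is either some [t_l] or a border term. *)
Lemma coords_in_subalgebra (K : nzRingType) (iota : {rmorphism K -> F})
    (G : F -> Prop) : order_ideal t ->
  (forall m, m \in border t ->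
     forall i, subalgebra_gen iota G (coords m i 0)) ->
  forall m i, subalgebra_gen iota G (coords m i 0).
Proof.
move=> [t_nonempty t_div] S_border.
have S_ideal m : m \in tval t -> forall i, subalgebra_gen iota G (coords m i 0).
  move=> /tnthP[j ->] i; rewrite coords_tnth !mxE.
  by case: (i == j); [exact: subalgebra_gen1 | exact: subalgebra_gen0].
move=> m; have [d] := ubnP (mdeg m); elim: d m => // d IHd m m_deg i.
have [m0 | m_neq0] := eqVneq m 0%MM.
  have [u u_t] : exists u, u \in tval t.
    by case: (tval t) t_nonempty => // u r _; exists u; apply: mem_head.
  (* The term 1 divides [u], so it belongs to the order ideal. *)
  apply: S_ideal; apply: (t_div u) => //.
  by rewrite m0; apply/mnm_lepP => k; rewrite mnm0E.
have [k m_k] : exists k, m k != 0%N.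
  apply/existsP; apply: contraNT m_neq0; rewrite negb_exists => /forallP m_k.
  by apply/eqP/mnmP => k; rewrite mnm0E; apply/eqP; rewrite -[_ == _]negbK.
have mE : (U_(k) + (m - U_(k)))%MM = m by rewrite addmC submK // lep1mP.
have m'_deg : (mdeg (m - U_(k))%MM < d)%N.
  by move: m_deg; rewrite -{1}mE mdegD mdeg1.
rewrite -mE coordsD summxE; apply: subalgebra_gen_sum => j; rewrite mxE.
apply: subalgebra_gen_mul; first exact: IHd.
have [in_t | notin_t] := boolP ((U_(k) + tnth t j)%MM \in tval t).
  exact: S_ideal.
apply: S_border; rewrite mem_filter notin_t.
by apply: allpairs_f; rewrite ?mem_enum ?mem_tnth.
Qed.

End CoordinatesOfTerms.

Section GenericPoints.

Context (K : fieldType) {n mu : nat}.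

Definition term_frac (i : 'I_mu) (m : 'X_{1..n}) : {fraction Qring K n mu} :=
  (term_at K m i)%:F.

Lemma term_fracD (i : 'I_mu) (u v : 'X_{1..n}) :
  term_frac i (u + v)%MM = term_frac i u * term_frac i v.
Proof.
rewrite /term_frac /term_at commr_mmap1_M ?rmorphM // => k x.
exact: mulrC.
Qed.

Lemma det_term_frac (s : mu.-tuple 'X_{1..n}) :
  \det (eval_mx term_frac s) = (Delta K s)%:F.
Proof.
rewrite -det_map_mx; congr (\det _).
by apply/matrixP => i j; rewrite !mxE.
Qed.

Lemma coords_border (t : mu.-tuple 'X_{1..n}) (nu : nat)
    (b : nu.-tuple 'X_{1..n}) (i : 'I_mu) (j : 'I_nu) :
  eval_mx term_frac t \in unitmx ->
  coords term_frac t (tnth b j) i 0 =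
    (Delta_border K t b i j)%:F / (Delta K t)%:F.
Proof.
move=> t_unit; rewrite /coords cramer_rule // det_term_frac; congr (_ / _).
rewrite -det_map_mx; congr (\det _); apply/matrixP => p q; rewrite !mxE.
by case: (q == i).
Qed.

End GenericPoints.

Theorem proposition3p8 (K : fieldType) (n mu nu : nat)
  (t : mu.-tuple 'X_{1..n}) (b : nu.-tuple 'X_{1..n})
  (t_uniq : uniq t) (t_ideal : order_ideal t)
  (b_uniq : uniq b) (b_border : b =i border t)
  (s : mu.-tuple 'X_{1..n}) (s_uniq : uniq s) :
  C_alg t b ((Delta K s)%:F / (Delta K t)%:F).
Proof.
(* When the denominator vanishes, the quotient is 0 by convention. *)
have [-> | t_det] := eqVneq ((Delta K t)%:F) 0.
  by rewrite invr0 mulr0; apply: subalgebra_gen0.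
have t_unit : eval_mx (term_frac K) t \in unitmx.
  by rewrite unitmxE unitfE det_term_frac.
rewrite -!det_term_frac det_coords //; apply: subalgebra_gen_det => i j.
rewrite mxE; apply: coords_in_subalgebra => //; first exact: term_fracD.
move=> m; rewrite -b_border => /tnthP[q ->] p.
by rewrite coords_border //; apply: subalgebra_gen_gen; exists p, q.
Qed.
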